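(* Let $n>6$ be a composite squarefree number. Then there is a (transitive) permutation group $G$ of degree $n$ with derived length $2$ which is not realised by a Hopf-Galois structure (of any type).
   Context: All permutation groups are finite and transitive. A permutation group of degree $n$ is a group $G$ with an injective homomorphism $G\to\mathrm{Perm}(X)$, $|X|=n$; up to isomorphism it is $G$ acting by left multiplication $\lambda$ on $X=G/G'$, where $G'$ (the stabiliser of a point) is a subgroup of index $n$ with trivial core. Let $L/K$ be a finite separable field extension with normal closure $E$. A Hopf-Galois structure on $L/K$ consists of a cocommutative $K$-Hopf algebra $H$ together with an action of $H$ on $L$ making $L$ an $H$-module algebra such that the $K$-linear map $L\otimes_K H\to \mathrm{End}_K(L)$, $x\otimes h\mapsto (y\mapsto x(h\cdot y))$, is bijective. By the theorem of Greither and Pareigis, with $\Gamma=\mathrm{Gal}(E/K)$, $\Gamma'=\mathrm{Gal}(E/L)$, $X=\Gamma/\Gamma'$, the Hopf-Galois structures on $L/K$ correspond bijectively to the regular subgroups $N$ of $\mathrm{Perm}(X)$ normalised by $\lambda(\Gamma)$; the isomorphism class of $N$ (a group of order $n=[L:K]$) is called the type of the structure. A separable extension $L/K$ realises the permutation group $G$ (with point stabiliser $G'$) if there is an isomorphism $G\to\mathrm{Gal}(E/K)$ taking $G'$ to $\mathrm{Gal}(E/L)$. $G$ is realised by a Hopf-Galois structure of type $N$ if an extension $L/K$ realising $G$ admits a Hopf-Galois structure of type $N$; equivalently, $\mathrm{Perm}(G/G')$ contains a regular subgroup isomorphic to $N$ and normalised by $\lambda(G)$. *)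

(* Defs.v *)
From HB Require Import structures.
From mathcomp Require Import all_boot all_order all_fingroup all_algebra.
From mathcomp Require Import all_solvable all_field.

Set Implicit Arguments.
Unset Strict Implicit.
Unset Printing Implicit Defensive.

Import GRing.Theory.
Local Open Scope ring_scope.

Section Tensor.
Variable K : fieldType.
Implicit Types U V W : vectType K.

(* U (x) V for finite-dimensional U and V, in coordinates: the matrix t stands
   for \sum_(i, j) t i j *: (u_i (x) v_j), where (u_i) and (v_j) are the bases
   vbasis {:U} and vbasis {:V}. The universal property is [tlift_tens],
   [tlift_unique] below. *)
Definition tensor U V : Type := 'M[K]_(\dim {:U}, \dim {:V}).
HB.instance Definition _ U V :=
  Vector.copy (tensor U V) 'M[K]_(\dim {:U}, \dim {:V}).

Definition tens U V (u : U) (v : V) : tensor U V :=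
  \matrix_(i, j) (coord (vbasis {:U}) i u * coord (vbasis {:V}) j v).

(* The linear map on U (x) V induced by a bilinear map b. For t = \sum x (x) y,
   [tlift (fun x y => E x y) t] is what Sweedler notation writes as the sum of
   the E x y. *)
Definition tlift U V W (b : U -> V -> W) (t : tensor U V) : W :=
  \sum_i \sum_j (t : 'M[K]_(_, _)) i j *: b (vbasis {:U})`_i (vbasis {:V})`_j.

Lemma tlift_tens U V W (b : U -> V -> W) :
    (forall v, linear (b^~ v)) -> (forall u, linear (b u)) ->
  forall u v, tlift b (tens u v) = b u v.
Proof.
move=> bl br u v; rewrite {2}(coord_vbasis (memvf u)).
pose f w : {linear U -> W} :=
  HB.pack (b^~ w) (GRing.isLinear.Build K U W *:%R (b^~ w) (bl w)).
pose g w : {linear V -> W} :=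
  HB.pack (b w) (GRing.isLinear.Build K V W *:%R (b w) (br w)).
rewrite -[RHS]/(f v _) linear_sum; apply: eq_bigr => i _; rewrite linearZ /=.
rewrite -[b _ v]/(g _ v) {2}(coord_vbasis (memvf v)) linear_sum scaler_sumr.
by apply: eq_bigr => j _; rewrite linearZ mxE scalerA.
Qed.

Lemma tlift_is_linear U V W (b : U -> V -> W) : linear (tlift b).
Proof.
move=> a s t; rewrite /tlift scaler_sumr -big_split; apply: eq_bigr => i _ /=.
rewrite scaler_sumr -big_split; apply: eq_bigr => j _ /=.
by rewrite !mxE scalerDl scalerA.
Qed.

HB.instance Definition _ U V W (b : U -> V -> W) :=
  GRing.isLinear.Build K (tensor U V) W *:%R (tlift b) (tlift_is_linear b).

Lemma tlift_unique U V W (f g : {linear tensor U V -> W}) :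
  (forall u v, f (tens u v) = g (tens u v)) -> f =1 g.
Proof.
move=> fg t.
have ->: t = \sum_i \sum_j (t : 'M[K]_(_, _)) i j *:
               tens (vbasis {:U})`_i (vbasis {:V})`_j.
  rewrite {1}[t](matrix_sum_delta (t : 'M[K]_(_, _))).
  apply: eq_bigr => i _; apply: eq_bigr => j _; congr (_ *: _).
  apply/matrixP=> i' j'; rewrite !mxE.
  by rewrite !coord_free ?(basis_free (vbasisP _)) // -natrM mulnb eq_sym [j' == _]eq_sym.
rewrite !linear_sum; apply: eq_bigr => i _; rewrite !linear_sum.
by apply: eq_bigr => j _; rewrite !linearZ fg.
Qed.

End Tensor.

Section HopfGalois.
Variable K : fieldType.

(* Requiring the carrier to be finite-dimensional (falgType) excludes nothing
   here: bijectivity of L (x) H -> End_K(L) forces dim H = [L : K]. *)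
Record hopf_structure (H : falgType K) := HopfStructure {
  comul : 'Hom(H, tensor H H);
  counit : 'Hom(H, K^o);
  antipode : 'End(H);
  (* coassociativity, with both sides read in H (x) (H (x) H) *)
  comulA : forall h : H,
    tlift (fun x y => tlift (fun x1 x2 => tens x1 (tens x2 y)) (comul x))
      (comul h)
    = tlift (fun x y => tens x (comul y)) (comul h);
  counitl : forall h : H, tlift (fun x y => counit x *: y) (comul h) = h;
  counitr : forall h : H, tlift (fun x y => counit y *: x) (comul h) = h;
  comul1 : comul 1 = tens 1 1;
  comulM : forall g h : H,
    comul (g * h)
    = tlift (fun g1 g2 => tlift (fun h1 h2 => tens (g1 * h1) (g2 * h2))
               (comul h)) (comul g);
  counit1 : counit 1 = 1;
  counitM : forall g h : H, counit (g * h) = counit g * counit h;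
  antipodel : forall h : H,
    tlift (fun x y => antipode x * y) (comul h) = counit h *: 1;
  antipoder : forall h : H,
    tlift (fun x y => x * antipode y) (comul h) = counit h *: 1
}.

Definition cocommutative (H : falgType K) (D : hopf_structure H) : Prop :=
  forall h : H, tlift (fun x y => tens y x) (comul D h) = comul D h.

(* [act h x] is the action of h on x. *)
Record module_algebra (L : fieldExtType K) (H : falgType K)
    (D : hopf_structure H) (act : 'Hom(H, 'End(L))) : Prop := ModuleAlgebra {
  act1 : forall x : L, act 1 x = x;
  actM : forall (g h : H) (x : L), act (g * h) x = act g (act h x);
  act_one : forall h : H, act h 1 = counit D h *: 1;
  act_mul : forall (h : H) (x y : L),
    act h (x * y) = tlift (fun h1 h2 => act h1 x * act h2 y) (comul D h)
}.

(* The K-linear map x (x) h |-> (y |-> x * (h . y)). *)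
Definition galois_map (L : fieldExtType K) (H : falgType K)
    (act : 'Hom(H, 'End(L))) : tensor L H -> 'End(L) :=
  tlift (fun (x : L) (h : H) => (amull x \o act h)%VF).

Definition admits_hopf_galois (L : fieldExtType K) : Prop :=
  exists (H : falgType K) (D : hopf_structure H) (act : 'Hom(H, 'End(L))),
    [/\ cocommutative D, module_algebra D act & bijective (galois_map act)].

End HopfGalois.

Section Realisation.

(* E is the normal closure of L over K; E itself is normal over K because it is
   a splittingFieldType. *)
Definition is_normal_closure (K : fieldType) (E : splittingFieldType K)
    (L : {subfield E}) : Prop :=
  forall M : {subfield E}, (L <= M)%VS -> normalField 1 M -> M = {:E}%AS.

Definition realises (T : finType) (G : {group {perm T}}) (K : fieldType)
    (E : splittingFieldType K) (L : {subfield E}) : Prop :=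
  [/\ separable 1 L, is_normal_closure L &
      exists (x : T) (f : {morphism G >-> gal_of {:E}}),
        isom G 'Gal({:E} / 1) f /\ f @* 'C_G[x | 'P] = 'Gal({:E} / L)]%g.

(* "of any type": the type of a Hopf-Galois structure is an invariant of it, so
   no type occurs here. *)
Definition realised_by_hopf_galois (T : finType) (G : {group {perm T}}) : Prop :=
  exists (K : fieldType) (E : splittingFieldType K) (L : {subfield E}),
    realises G L /\ admits_hopf_galois (subvs_of L).

Definition has_derived_length (gT : finGroupType) (G : {group gT}) (d : nat) :=
  (G^`(d) = 1 /\ forall k, (k < d)%N -> G^`(k) <> 1)%g.

Definition squarefree (n : nat) : Prop :=
  forall d : nat, (d ^ 2 %| n)%N -> d = 1%N.

Definition composite (n : nat) : Prop := (1 < n)%N /\ ~~ prime n.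

End Realisation.

(* Main.v *)
From HB Require Import structures.
Require Import Defs.
From mathcomp Require Import all_boot all_order all_fingroup all_algebra.
From mathcomp Require Import all_solvable all_field zify.

(** The obstruction is a fixed-point count. If G acts on T and is realised by a
Hopf-Galois structure, then an element a of G that fixes a point has a number
of fixed points dividing #|T| ([card_fix_dvd]). In the language of Greither
and Pareigis: G normalises a regular group N of permutations of T; identifying
T with N through a fixed point of a makes a an automorphism of N, and its fixed
points form a subgroup of N.

Since n > 6 is composite, it has a divisor m with 2 < m < n. The wreath product
of C_(n/m) by C_m acts on the residues modulo n, with the residue classes modulo
m as blocks. It is transitive, nonabelian, and an extension of a cyclic group by
an abelian one, so its derived length is 2. The element that moves a single
block fixes n - n/m points, which is less than n but more than n/2, hence does
not divide n.

The count is obtained directly from the Hopf algebra, by extending scalars to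
the field E that contains the conjugates of L. The points of T are the
K-embeddings of L in E. An element c of E (x) H sends a K-linear map s : L -> E
to the map s o c : y |-> \sum c_i s (h_i y), and bijectivity of the Galois map
says that c |-> s o c is a bijection onto the K-linear maps for every embedding
s (lemmas [hact_inj] and [hact_surj]). If s o c is an embedding for one
embedding s, then c is grouplike, and s' o c is an embedding for every s'
([hact_ahom]). So once an embedding x is chosen as the origin, each embedding t
is x o c_t for a unique grouplike c_t, and (s, t) |-> s o c_t is a group law on
the embeddings. When an automorphism g of E fixes x, the embeddings fixed by g
are those for which g fixes c_t, and they form a subgroup; Lagrange's theorem
finishes the proof. *)

Set Implicit Arguments.
Unset Strict Implicit.
Unset Printing Implicit Defensive.
Import GRing.Theory.

(** * Lagrange's theorem for a finite left-cancellative monoid *)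

(** Left translations embed the monoid in the permutations of [T], where closed
subsets that contain the identity become subgroups. *)
Lemma closed_subset_dvd (T : finType) (op : T -> T -> T) (x0 : T)
    (F : {set T}) :
    associative op -> left_id x0 op -> right_id x0 op ->
    (forall s, injective (op s)) ->
    x0 \in F -> {in F &, forall s t, op s t \in F} ->
  (#|F| %| #|T|)%N.
Proof.
move=> opA op1l op1r op_inj F1 Fop.
pose rho s := perm (op_inj s).
have rhoM s t : rho (op s t) = (rho t * rho s)%g.
  by apply/permP=> u; rewrite permM !permE opA.
have rho_inj : injective rho.
  by move=> s t /permP/(_ x0); rewrite !permE !op1r.
have rho1 : rho x0 = 1%g by apply/permP=> u; rewrite permE perm1 op1l.
have grp (A : {set T}) : x0 \in A -> {in A &, forall s t, op s t \in A} ->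
    group_set (rho @: A).
  move=> A1 Aop; apply/group_setP; split; first by rewrite -rho1 imset_f.
  move=> _ _ /imsetP[s As ->] /imsetP[t At ->].
  by rewrite -rhoM imset_f ?Aop.
have grpF := grp F F1 Fop.
have grpT := grp setT (in_setT _) (fun _ _ _ _ => in_setT _).
rewrite -cardsT -!(card_imset _ rho_inj).
have sFT : Group grpF \subset Group grpT by apply/imsetS/subsetT.
exact: cardSg sFT.
Qed.

Local Open Scope ring_scope.

(** * Embeddings of L under a Hopf-Galois structure *)

Section HopfGaloisEmbeddings.
Variables (K : fieldType) (L E : fieldExtType K) (H : falgType K).
Variables (D : hopf_structure H) (act : 'Hom(H, 'End(L))).
Hypotheses (actD : module_algebra D act) (act_bij : bijective (galois_map act)).

Local Notation h i := (vbasis {:H})`_i.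
Local Notation l j := (vbasis {:L})`_j.

Definition action_mx : 'M[L]_(\dim {:H}, \dim {:L}) :=
  \matrix_(i, j) act (h i) (l j).

Lemma galois_mapE (t : tensor L H) (y : L) :
  galois_map act t y
    = \sum_j (\sum_i (t : 'M[K]_(_, _)) i j *: l i) * act (h j) y.
Proof.
rewrite /galois_map /tlift exchange_big sum_lfunE; apply: eq_bigr => j _.
rewrite sum_lfunE mulr_suml; apply: eq_bigr => i _.
by rewrite !lfunE /= !lfunE /= lfunE /= scalerAl.
Qed.

(** Bijectivity of the Galois map makes the basis of [H] a basis of End_K(L) as a
left [L]-space: injectivity makes the rows of [action_mx] free over [L], and
surjectivity makes them span. The matrix is square only as a
consequence, which is why its inverse is a two-sided one and not [invmx]. *)
Lemma action_mx_inv :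
  exists P, action_mx *m P = 1%:M /\ P *m action_mx = 1%:M.
Proof.
have free : row_free action_mx.
  apply: inj_row_free => c cB0.
  (* The element \sum_j c_j (x) h_j, which the Galois map sends to 0. *)
  pose t : tensor L H := \matrix_(i, j) coord (vbasis {:L}) i (c 0 j).
  have tc j : \sum_i (t : 'M[K]_(_, _)) i j *: l i = c 0 j.
    rewrite [RHS](coord_vbasis (memvf _)); apply: eq_bigr => i _.
    by rewrite mxE.
  have: galois_map act t = galois_map act 0.
    apply/lfunP=> y; rewrite [in RHS]/galois_map linear0 zero_lfunE.
    rewrite (coord_vbasis (memvf y)) linear_sum big1 // => k _.
    rewrite linearZ /= galois_mapE.
    move/rowP/(_ k): cB0; rewrite !mxE => cB0.
    rewrite (eq_bigr (fun j => c 0 j * action_mx j k)) ?cB0 ?scaler0 //.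
    by move=> j _; rewrite tc mxE.
  move/(bij_inj act_bij) => t0; apply/rowP=> j; rewrite mxE -tc.
  by rewrite t0 big1 // => i _; rewrite mxE scale0r.
have full : row_full action_mx.
  rewrite -sub1mx; apply/row_subP=> k.
  have [g galK Kgal] := act_bij.
  (* Hit the k-th unit row through the endomorphism that picks the k-th
     coordinate. *)
  have flin : linear (fun y : L => coord (vbasis {:L}) k y *: (1 : L)).
    by move=> a y z; rewrite linearP scalerDl scalerA.
  pose flin' := GRing.isLinear.Build K L L *:%R _ flin.
  pose f := linfun (HB.pack (fun y : L => coord (vbasis {:L}) k y *: (1 : L))
                      flin' : {linear L -> L}).
  pose t := g f; apply/submxP.
  exists (\row_j \sum_i (t : 'M[K]_(_, _)) i j *: l i).
  apply/rowP=> i; rewrite !mxE.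
  transitivity (galois_map act t (l i)).
    rewrite /t Kgal /f lfunE /= coord_free ?(basis_free (vbasisP _)) //.
    by rewrite scaler_nat eq_sym.
  by rewrite galois_mapE; apply: eq_bigr => j _; rewrite !mxE.
have [P BP] := row_freeP free; have [Q QB] := row_fullP full.
exists P; split=> //.
by rewrite -[P]mul1mx -QB -(mulmxA Q) BP mulmx1.
Qed.

(** The action on [s] of the element \sum_i c_i (x) h_i of E (x) H. Elements of
E (x) H are represented by their coordinates over the basis of [H]. *)
Definition hact (c : 'rV[E]_(\dim {:H})) (s : 'AHom(L, E)) (y : L) : E :=
  \sum_i c 0 i * s (act (h i) y).

Lemma hact_linear c s : linear (hact c s).
Proof.
move=> a y z; rewrite /hact scaler_sumr -big_split; apply: eq_bigr => i _ /=.
by rewrite !linearP mulrDr -scalerAr.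
Qed.

HB.instance Definition _ c s :=
  GRing.isLinear.Build K L E *:%R (hact c s) (hact_linear c s).

Lemma hact_basis c s :
  \row_j hact c s (l j) = c *m map_mx s action_mx.
Proof. by apply/rowP=> j; rewrite !mxE; apply: eq_bigr => i _; rewrite !mxE. Qed.

Lemma eq_on_basis (f g : {linear L -> E}) :
  \row_(j < \dim {:L}) f (l j) = \row_j g (l j) -> f =1 g.
Proof.
move=> fg y; rewrite (coord_vbasis (memvf y)) !linear_sum.
apply: eq_bigr => j _; rewrite !linearZ; congr (_ *: _).
by move/rowP/(_ j): fg; rewrite !mxE.
Qed.

(** As [s] is a field embedding, the image of [action_mx] under [s] is still
invertible. *)
Lemma hact_inj c d s : hact c s =1 hact d s -> c = d.
Proof.
move=> cd; have [P [BP _]] := action_mx_inv.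
have: c *m map_mx s action_mx = d *m map_mx s action_mx.
  by rewrite -!hact_basis; apply/rowP=> j; rewrite !mxE cd.
move/(congr1 (mulmx^~ (map_mx s P))).
by rewrite -!mulmxA -map_mxM BP map_mx1 !mulmx1.
Qed.

Lemma hact_surj (f : {linear L -> E}) s : exists c, hact c s =1 f.
Proof.
have [P [_ PB]] := action_mx_inv.
exists (\row_(j < \dim {:L}) f (l j) *m map_mx s P); apply: eq_on_basis.
by rewrite hact_basis -mulmxA -map_mxM PB map_mx1 mulmx1.
Qed.

(** The hypothesis forces [c] to be grouplike. Write Q for the matrix of the
coproduct of [c]. Multiplicativity of [s] acted on by [c] is the equation
A^T Q A = (c A)^T (c A), where A is the invertible image of [action_mx] under
[s]; hence Q = c^T c. That equation and the counit condition do not mention [s],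
so they give the conclusion at every [s']. *)
Lemma hact_ahom c (s t : 'AHom(L, E)) : hact c s =1 t ->
  forall s', exists u : 'AHom(L, E), hact c s' =1 u.
Proof.
move=> cst s'.
pose Q : 'M[E]_(\dim {:H}) :=
  \sum_i c 0 i *: map_mx (in_alg E) (comul D (h i) : 'M[K]_(_, _)).
have hactM (r : 'AHom(L, E)) y z : hact c r (y * z) =
    \sum_j \sum_k Q j k * (r (act (h j) y) * r (act (h k) z)).
  rewrite /hact.
  transitivity (\sum_i \sum_j \sum_k c 0 i *
     ((comul D (h i) : 'M[K]_(_, _)) j k)%:A
       * (r (act (h j) y) * r (act (h k) z))).
    apply: eq_bigr => i _; rewrite (act_mul actD) /tlift linear_sum mulr_sumr.
    apply: eq_bigr => j _; rewrite linear_sum mulr_sumr; apply: eq_bigr => k _.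
    by rewrite linearZ rmorphM -mulrA mulr_algl.
  rewrite exchange_big; apply: eq_bigr => j _.
  rewrite exchange_big; apply: eq_bigr => k _.
  rewrite /Q summxE mulr_suml; apply: eq_bigr => i _.
  by rewrite !mxE.
have hact1 (r : 'AHom(L, E)) : hact c r 1 = \sum_i c 0 i * (counit D (h i))%:A.
  apply: eq_bigr => i _.
  by rewrite (act_one actD) linearZ rmorph1.
have Qc : Q = c^T *m c.
  have [P [BP _]] := action_mx_inv.
  pose A := map_mx s action_mx; pose A' := map_mx s P.
  have AA' : A *m A' = 1%:M by rewrite -map_mxM BP map_mx1.
  have A'A : A'^T *m A^T = 1%:M by rewrite -trmx_mul AA' trmx1.
  have eqA : A^T *m Q *m A = (c *m A)^T *m (c *m A).
    rewrite -hact_basis; apply/matrixP=> j k.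
    have -> : ((\row_j0 hact c s (l j0))^T *m \row_j0 hact c s (l j0)) j k
              = hact c s (l j * l k).
      by rewrite mxE big_ord1 !mxE !cst -rmorphM.
    rewrite hactM mxE exchange_big; apply: eq_bigr => b _.
    rewrite !mxE mulr_suml; apply: eq_bigr => a _.
    by rewrite !mxE mulrCA mulrA.
  move/(congr1 (fun M => A'^T *m M *m A')): eqA.
  by rewrite trmx_mul !mulmxA A'A !mul1mx -!mulmxA AA' !mulmx1.
have fP : ahom_in {:L} (linfun (hact c s')).
  apply/ahomP_tmp; split=> [|y z]; rewrite !lfunE /=.
    by rewrite hact1 -(hact1 s) cst rmorph1.
  rewrite hactM /hact mulr_suml; apply: eq_bigr => j _.
  rewrite mulr_sumr; apply: eq_bigr => k _.
  by rewrite Qc mxE big_ord1 mxE mulrACA.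
by exists (AHom fP) => y; rewrite /= lfunE.
Qed.

(** [b] is the product of [c] and [d] in E (x) H; what matters is that it does
not depend on [s]. *)
Lemma hact_comp c d : exists b, forall s t : 'AHom(L, E),
  hact c s =1 t -> hact d t =1 hact b s.
Proof.
pose b : 'rV[E]_(\dim {:H}) := \row_k \sum_i \sum_j
  d 0 j * c 0 i * (coord (vbasis {:H}) k (h i * h j))%:A.
exists b => s t cst y.
rewrite /hact.
transitivity (\sum_j \sum_i \sum_k d 0 j * c 0 i *
   (coord (vbasis {:H}) k (h i * h j))%:A * s (act (h k) y)).
  apply: eq_bigr => j _; rewrite -cst /hact mulr_sumr; apply: eq_bigr => i _.
  rewrite -(Defs.actM actD) {1}(coord_vbasis (memvf (h i * h j))).
  rewrite linear_sum sum_lfunE linear_sum !mulr_sumr; apply: eq_bigr => k _.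
  by rewrite linearZ scale_lfunE linearZ -!mulrA mulr_algl.
rewrite exchange_big; under eq_bigr do rewrite exchange_big.
rewrite exchange_big; apply: eq_bigr => k _; rewrite mxE mulr_suml.
by apply: eq_bigr => i _; rewrite mulr_suml.
Qed.

Lemma hact_unit : exists u, forall s, hact u s =1 s.
Proof.
exists (\row_i (coord (vbasis {:H}) i 1)%:A) => s y.
rewrite -[in RHS](Defs.act1 actD y) [in RHS](coord_vbasis (memvf (1 : H))).
rewrite linear_sum sum_lfunE linear_sum; apply: eq_bigr => i _.
by rewrite linearZ scale_lfunE linearZ mxE mulr_algl.
Qed.

Lemma hact_aut (g : 'AEnd(E)) c s y :
  g (hact c s y) = hact (map_mx g c) (g \o s)%AF y.
Proof.
rewrite /hact linear_sum; apply: eq_bigr => i _.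
by rewrite rmorphM mxE /= lfunE.
Qed.

(** Grouplike elements of E (x) H act simply transitively on the embeddings, which
makes [T] a group with identity [x0]. As [g] fixes [e x0], the embeddings that it
fixes correspond to the grouplike elements that it fixes, and these are closed
under the product. *)
Theorem card_fixed_embeddings_dvd (T : finType) (e : T -> 'AHom(L, E))
    (g : 'AEnd(E)) (x0 : T) :
    injective e -> (forall u, exists t, u = e t) -> (g \o e x0)%AF = e x0 ->
  (#|[set t | (g \o e t)%AF == e t]| %| #|T|)%N.
Proof.
move=> e_inj0 e_surj gx0.
have e_inj s t : e s =1 e t -> s = t.
  by move=> st; apply/e_inj0/val_inj/lfunP.
have /fin_all_exists[c cP] t : exists c, hact c (e x0) =1 e t.
  exact: hact_surj.
have c_inj s t : c s = c t -> s = t.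
  by move=> st; apply: e_inj => y; rewrite -!cP st.
have /fin_all_exists[op opP] (p : T * T) :
    exists u, hact (c p.2) (e p.1) =1 e u.
  have [u uP] := hact_ahom (cP p.2) (e p.1).
  by have [r ur] := e_surj u; exists r => y; rewrite uP ur.
apply: (@closed_subset_dvd _ (fun s t => op (s, t)) x0).
(* Both bracketings are [e s] acted on by the product of [c t] and [c r], which
   is recognised as [c (op (t, r))] at the origin. *)
- move=> s t r; have [b bP] := hact_comp (c t) (c r).
  have bE : b = c (op (t, r)).
    apply: (@hact_inj _ _ (e x0)) => y.
    by rewrite -(bP _ _ (cP t)) (opP (t, r)) cP.
  apply: e_inj => y; rewrite -[LHS]opP /= -bE -(bP _ _ (opP (s, t))).
  exact: (opP (op (s, t), r)).
- by move=> t; apply: e_inj => y; rewrite -opP cP.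
- have [u uP] := hact_unit.
  have uE : u = c x0 by apply: (@hact_inj _ _ (e x0)) => y; rewrite uP cP.
  by move=> s; apply: e_inj => y; rewrite -opP /= -uE uP.
- move=> s t t' stt'; apply: c_inj; apply: (@hact_inj _ _ (e s)) => y.
  by rewrite (opP (s, t)) (opP (s, t')) stt'.
- by rewrite inE gx0.
(* As [g] fixes both [e x0] and [e t], it fixes [c t], by uniqueness. *)
move=> s t; rewrite !inE => /eqP gs /eqP gt.
have gc : map_mx g (c t) = c t.
  apply: (@hact_inj _ _ (e x0)) => y.
  by rewrite -[in LHS]gx0 -hact_aut !cP -[in RHS]gt /= lfunE.
apply/eqP/val_inj/lfunP=> y.
by rewrite /= lfunE /= -(opP (s, t)) /= hact_aut gc gs.
Qed.

End HopfGaloisEmbeddings.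

(** * Fixed points in a group realised by a Hopf-Galois structure *)

(** By transitivity, points of [T] correspond to cosets of the stabiliser, that
is, to restrictions to [L] of automorphisms of [E]. These are all the
embeddings of [L] in [E] because [E] is normal, and the action of [G] becomes
composition. *)
Theorem card_fix_dvd (T : finType) (G : {group {perm T}}) (a : {perm T}) :
    [transitive G, on [set: T] | 'P]%g -> realised_by_hopf_galois G ->
    a \in G -> 'Fix_'P[a]%g != set0 ->
  (#|'Fix_'P[a]%g| %| #|T|)%N.
Proof.
move=> trG [K [E [L [[_ _ [x [f [isoGf stabf]]]] [H [D [act]]]]]]].
move=> [_ actD act_bij] Ga /set0Pn[y0 fix_y0].
have [injf imf] := isomP isoGf.
have /fin_all_exists[b bP] t : exists b, b \in G /\ t = aperm x b.
  have /imsetP[b Gb tb] : t \in orbit 'P G x by rewrite (atransP trG) ?inE.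
  by exists b.
pose i : 'AHom(subvs_of L, E) := linfun_ahom (@vsval _ _ L).
pose e t : 'AHom(subvs_of L, E) := ((f (b t) : 'AEnd(E)) \o i)%AF.
have eE t y : e t y = f (b t) (vsval y) by rewrite /= lfunE /= lfunE.
have stabE c : c \in G -> (f c \in 'Gal({:E} / L)%g) = (aperm x c == x).
  move=> Gc; rewrite -stabf; apply/idP/eqP=> [/morphimP[d Gd] | xc].
    case/setIP=> _ /astab1P xd fcd.
    by rewrite (injmP injf _ _ Gc Gd fcd).
  by rewrite mem_morphim // inE Gc; apply/astab1P.
have eqEP c d : c \in G -> d \in G ->
    {in L, f c =1 f d} <-> aperm x c = aperm x d.
  move=> Gc Gd; have Gcd : (c * d^-1)%g \in G by rewrite groupM ?groupV.
  have fcd : f c = (f (c * d^-1) * f d)%g by rewrite -morphM ?mulgKV.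
  have cdE : (f (c * d^-1)%g \in 'Gal({:E} / L)%g) = (aperm x c == aperm x d).
    rewrite stabE //; apply/eqP/eqP => [xcd | xcd].
      by rewrite -[in RHS]xcd -!(actM 'P) /= mulgKV.
    by rewrite (actM 'P) /= xcd; apply: (actK 'P).
  apply: (iff_trans _ (iff_sym (rwP eqP))); rewrite -cdE gal_kHom ?subvf //.
  split=> [cd | /kAHomP cd y Ly].
    apply/kAHomP => y Ly; rewrite morphM ?groupV //.
    by rewrite galM ?memvf // cd // -galM ?memvf // morphV // mulgV gal_id.
  by rewrite fcd galM ?memvf // cd.
have eM t c : c \in G -> (f c \o e t)%AF = e (aperm t c).
  move=> Gc; have [Gt xt] := bP t; have [Gtc xtc] := bP (aperm t c).
  apply/val_inj/lfunP=> y; rewrite /= lfunE /= !eE -galM ?memvf // -morphM //.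
  have [_] := eqEP _ _ (groupM Gt Gc) Gtc; apply; last exact: subvsP.
  by rewrite -xtc [in RHS]xt; apply: actM.
have e_inj : injective e.
  move=> s t est; have [Gs ->] := bP s; have [Gt ->] := bP t.
  by apply/(eqEP _ _ Gs Gt) => y Ly; rewrite -(vsprojK Ly) -!eE est.
have e_surj (u : 'AHom(subvs_of L, E)) : exists t, u = e t.
  pose v := (u \o linfun (@vsproj _ _ L))%VF.
  have vE y : v (vsval y) = u y by rewrite /v lfunE /= lfunE /= vsvalK.
  have homv : kHom 1 L v.
    apply/kHomP_tmp; split=> [_ /vlineP[k ->] | y z Ly Lz].
      by have v1 := vE 1; rewrite !rmorph1 in v1; rewrite linearZ /= v1.
    have vM := vE (vsproj L y * vsproj L z); rewrite !rmorphM /= -!vE in vM.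
    by rewrite !vsprojK in vM.
  have [g] := kHom_to_gal (introT andP (conj (sub1v L) (subvf L)))
                (normalFieldf 1) homv.
  rewrite -imf => /morphimP[c Gc _ ->] vc.
  exists (aperm x c); have [Gt xt] := bP (aperm x c).
  apply/val_inj/lfunP=> y; rewrite eE.
  have [_ <-] := eqEP _ _ Gc Gt; rewrite ?subvsP //.
  by rewrite -vc ?subvsP // vE.
have -> : 'Fix_'P[a]%g = [set t | (f a \o e t)%AF == e t].
  by apply/setP=> t; rewrite inE eM // (inj_eq e_inj) !inE sub1set inE.
apply: (card_fixed_embeddings_dvd actD act_bij e_inj e_surj (x0 := y0)).
by rewrite eM // (afix1P fix_y0).
Qed.

(** * The wreath product of cyclic groups *)

Section WreathProduct.
Variables (n' m : nat).
Local Notation n := n'.+2.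
Hypotheses (m_dvd : (m %| n)%N) (m_gt2 : (2 < m)%N) (m_ltn : (m < n)%N).

Definition shift : {perm 'I_n} := perm (@addIr _ (1 : 'I_n)).

(** Addition of [m] on the block of [k], the residue class of [k] modulo [m]. *)
Definition block_fun (k : nat) (y : 'I_n) : 'I_n :=
  if (y == k %[mod m])%N then y + m%:R else y.

Lemma val_addr_mod (y z : 'I_n) : (y + z = val (y + z)%R %[mod m])%N.
Proof. by rewrite /= modn_dvdm. Qed.

Lemma val_natr_mod k : (val (k%:R : 'I_n) = k %[mod m])%N.
Proof. by rewrite /= Zp_nat /= modn_dvdm. Qed.

Lemma addm_mod (y : 'I_n) : (val (y + m%:R)%R = y %[mod m])%N.
Proof. by rewrite -val_addr_mod -modnDmr val_natr_mod modnn addn0. Qed.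

Lemma block_fun_inj k : injective (block_fun k).
Proof.
move=> y z; rewrite /block_fun.
case: ifP => yk; case: ifP => zk //; first exact: addIr.
  by move=> yz; move: zk; rewrite -yz addm_mod yk.
by move=> yz; move: yk; rewrite yz addm_mod zk.
Qed.

Definition block_shift k : {perm 'I_n} := perm (@block_fun_inj k).

Lemma block_shift_comm j k : commute (block_shift j) (block_shift k).
Proof.
apply/permP=> y; rewrite !permM !permE /block_fun.
by case yj: (y == j %[mod m])%N; case yk: (y == k %[mod m])%N;
  rewrite ?addm_mod ?yj ?yk // addrAC.
Qed.

Lemma shift_mod (y : 'I_n) k :
  (shift y == k.+1 %[mod m])%N = (y == k %[mod m])%N.
Proof.
by rewrite permE -val_addr_mod -modnDmr (val_natr_mod 1) modnDmr -(addn1 k) eqn_modDr.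
Qed.

Lemma block_shiftJ k : (block_shift k ^ shift)%g = block_shift k.+1.
Proof.
apply/permP=> z; rewrite -[z](permKV shift) permJ; move: (_ z) => y.
rewrite [block_shift _ _]permE [RHS]permE /block_fun shift_mod.
by case: ifP => // _; rewrite !permE addrAC.
Qed.

Definition block_shifts : {set {perm 'I_n}} :=
  [set block_shift (k : 'I_m) | k : 'I_m].

Lemma block_shift_mod k : block_shift (k %% m) = block_shift k.
Proof. by apply/permP=> y; rewrite !permE /block_fun modn_mod. Qed.

Lemma block_shiftsP k : block_shift k \in block_shifts.
Proof.
have m_gt0 : (0 < m)%N by apply: leq_trans m_gt2.
by rewrite -block_shift_mod; apply/imsetP; exists (Ordinal (ltn_pmod k m_gt0)).
Qed.

(** The base group, a product of [m] copies of C_(n/m), extended by [shift], which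
permutes the blocks cyclically. The power [shift ^+ m] lies in the base group, so
this is the whole wreath product of C_(n/m) by C_m. *)
Definition wreath : {group {perm 'I_n}} :=
  (<<block_shifts>> <*> <[shift]>)%G.

Lemma block_shifts_abelian : abelian <<block_shifts>>.
Proof.
rewrite abelian_gen; apply/centsP=> _ /imsetP[j _ ->] _ /imsetP[k _ ->].
exact: block_shift_comm.
Qed.

Lemma shift_norm : shift \in 'N(<<block_shifts>>)%g.
Proof.
rewrite -cycle_subG (subset_trans _ (norm_gen _)) // cycle_subG.
apply/normP/eqP; rewrite eqEcard cardJg leqnn andbT.
apply/subsetP=> _ /imsetP[_ /imsetP[k _ ->] ->].
by rewrite block_shiftJ block_shiftsP.
Qed.

(** The base group is abelian and normal, with cyclic quotient. *)
Lemma wreath_der2 : (wreath^`(2) = 1)%g.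
Proof.
have sG'B : (wreath^`(1) \subset <<block_shifts>>)%g.
  apply: der1_min; rewrite /wreath /=.
    by rewrite join_subG normG cycle_subG shift_norm.
  by rewrite quotientYidl ?cycle_subG ?shift_norm // quotient_abelian ?cycle_abelian.
apply/eqP; rewrite -subG1.
apply: subset_trans (commgSS sG'B sG'B) _.
by rewrite subG1; apply/eqP/commG1P; apply: block_shifts_abelian.
Qed.

Lemma shift_wreath : shift \in wreath.
Proof. by rewrite (subsetP (joing_subr _ _)) ?cycle_id. Qed.

Lemma block_shift_wreath k : block_shift k \in wreath.
Proof. by rewrite (subsetP (joing_subl _ _)) ?mem_gen ?block_shiftsP. Qed.

Lemma block_shift_neq y k : (block_shift k y != y) = (y == k %[mod m])%N.
Proof.
rewrite permE /block_fun; case: ifP => _; last by rewrite eqxx.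
rewrite -subr_eq0 addrC addKr -val_eqE /= Zp_nat /= modn_small //.
by rewrite -lt0n (leq_trans _ m_gt2).
Qed.

Lemma wreath_nonabelian : ~~ abelian wreath.
Proof.
apply/negP=> /centsP/(_ _ (block_shift_wreath 0) _ shift_wreath) comm.
have /permP/(_ 0) t01 : block_shift 1 = block_shift 0.
  by rewrite -block_shiftJ conjgE comm mulKg.
have := block_shift_neq 0 1; rewrite t01 block_shift_neq eqxx /=.
by rewrite mod0n modn_small // (leq_trans _ m_gt2).
Qed.

Lemma shiftX k (y : 'I_n) : (shift ^+ k)%g y = y + k%:R.
Proof.
elim: k => [|k IH]; first by rewrite perm1 addr0.
by rewrite expgSr permM IH permE -addrA natr1.
Qed.

Lemma wreath_trans : [transitive wreath, on [set: 'I_n] | 'P]%g.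
Proof.
apply/imsetP; exists 0; rewrite ?inE //; apply/esym/setP=> y; rewrite [RHS]inE.
apply/orbitP; exists (shift ^+ y)%g; first by rewrite groupX ?shift_wreath.
by rewrite /= apermE shiftX add0r natr_Zp.
Qed.

(** The moved points form one of at least three blocks of equal size, so the fixed
points are more than half of all points, without being all of them. *)
Lemma card_fix_block_shift : ~~ (#|'Fix_'P[block_shift 0]%g| %| n)%N.
Proof.
pose C k := [set y : 'I_n | (y == k %[mod m])%N].
have CS k : #|C k.+1| = #|C k|.
  rewrite -(card_imset (C k) (@perm_inj _ shift)); congr #|pred_of_set _|.
  apply/setP=> z; rewrite -[z](permKV shift); move: (_ z) => y.
  by rewrite (mem_imset _ _ (@perm_inj _ shift)) !inE shift_mod.
have fixE : 'Fix_'P[block_shift 0]%g = ~: C 0%N.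
  apply/setP=> y; rewrite !inE sub1set inE /= -block_shift_neq negbK.
  by rewrite apermE.
have C0 : (0 < #|C 0%N|)%N by apply/card_gt0P; exists 0; rewrite inE.
have le3 : (3 * #|C 0%N| <= n)%N.
  have disj j k : (j < k < m)%N -> [disjoint C j & C k].
    case/andP=> jk km; apply/pred0P=> y /=; rewrite !inE.
    apply/negP=> /andP[/eqP-> /eqP]; rewrite !modn_small ?(ltn_trans jk) //.
    by move=> jkE; rewrite jkE ltnn in jk.
  have /eqP U01 : #|C 0%N :|: C 1%N| == (#|C 0%N| + #|C 1%N|)%N.
    by rewrite (leq_card_setU _ _).2 disj // (ltn_trans _ m_gt2).
  have /eqP U012 : #|(C 0%N :|: C 1%N) :|: C 2%N| ==
                     (#|C 0%N :|: C 1%N| + #|C 2%N|)%N.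
    rewrite (leq_card_setU _ _).2 -setI_eq0 setIUl setU_eq0 !setI_eq0.
    by rewrite !disj.
  have := max_card (C 0%N :|: C 1%N :|: C 2%N).
  by rewrite U012 U01 !CS card_ord !mulSn addn0 addnA.
rewrite fixE cardsCs setCK card_ord; apply/negP=> /dvdnP[q qn].
have: (#|C 0%N| <= n)%N by apply: leq_trans le3; rewrite leq_pmull.
move: qn le3 C0; move: #|_| => c.
case: q => [|[|q]] nE le3 c_gt0 le_cn; [lia|lia|nia].
Qed.

End WreathProduct.

(** * A transitive metabelian group not realised by a Hopf-Galois structure *)

(** The smallest prime factor serves unless it is 2; then the cofactor does. *)
Lemma composite_divisor_gt2 n : (4 < n)%N -> composite n ->
  exists m, [/\ (m %| n)%N, (2 < m)%N & (m < n)%N].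
Proof.
move=> n_gt4 [n_gt1 n_npr]; have pP := pdiv_prime n_gt1.
have [p_le2 | p_gt2] := leqP (pdiv n) 2.
  have p2 : pdiv n = 2%N by apply/eqP; rewrite eqn_leq p_le2 prime_gt1.
  have n2 : (2 %| n)%N by rewrite -p2 pdiv_dvd.
  exists (n %/ 2)%N; split; [exact: dvdn_div | lia | lia].
exists (pdiv n); split; rewrite ?pdiv_dvd // ltn_neqAle pdiv_leq ?(ltnW n_gt1) //.
by rewrite andbT; apply: contraNneq n_npr => <-.
Qed.

Theorem theorem3p4 (n : nat) (n_gt6 : (6 < n)%N)
    (n_composite : composite n) (n_squarefree : squarefree n) :
  exists G : {group {perm 'I_n}},
    [/\ [transitive G, on [set: 'I_n] | 'P]%g,
        has_derived_length G 2 &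
        ~ realised_by_hopf_galois G].
Proof.
have [|m [m_dvd m_gt2 m_ltn]] := composite_divisor_gt2 _ n_composite.
  exact: leq_trans n_gt6.
clear n_composite n_squarefree; case: n n_gt6 m_dvd m_ltn => [|[|n']] // _.
move=> m_dvd m_ltn; exists (wreath m_dvd); split.
- exact: wreath_trans.
- split=> [|k k_lt2 Gk]; first exact: wreath_der2.
  have /negP := wreath_nonabelian m_dvd m_gt2 m_ltn; apply.
  rewrite (sameP derG1P eqP) -subG1 -Gk; case: k k_lt2 Gk => [|[|]] // _ _.
  exact: der_sub.
move=> real; have := card_fix_block_shift m_dvd m_gt2 m_ltn.
rewrite -[X in (_ %| X)%N](card_ord n'.+2) => /negP; apply.
apply: card_fix_dvd real _ _; rewrite ?block_shift_wreath //.
  exact: wreath_trans.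
apply/set0Pn; exists 1; apply/afix1P/eqP; rewrite -[_ == _]negbK.
by rewrite block_shift_neq // mod0n modn_small // (leq_trans _ m_gt2).
Qed.
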